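(* Let $\nu_1,\nu_2>0$, $\mu=\sqrt{\nu_1/\nu_2}$, and $0<\widetilde\omega_1<\widetilde\omega_2$. The min-max problem $$\min_{q>0}\Big(\max_{\widetilde\omega_1\le\widetilde\omega\le\widetilde\omega_2}\rho(\widetilde\omega,q)\Big)$$ has a unique minimizer $q^*$, and it is given by $q^*=\sqrt{2\,\widetilde\omega_1\widetilde\omega_2}$.
   Context: For $\widetilde\omega>0$ and $q>0$, the convergence factor is $$\rho(\widetilde\omega,q)=\sqrt{\frac{(q-\widetilde\omega)^2+\widetilde\omega^2}{(q+\mu\widetilde\omega)^2+\mu^2\widetilde\omega^2}\cdot\frac{(q-\widetilde\omega)^2+\widetilde\omega^2}{(q+\frac1\mu\widetilde\omega)^2+\frac1{\mu^2}\widetilde\omega^2}}.$$ The interval $[\widetilde\omega_1,\widetilde\omega_2]$ is the frequency range ($\widetilde\omega_1=\sqrt{\pi/(4T)}$, $\widetilde\omega_2=\sqrt{\pi/(2\Delta t)}$ for a final time $T$ and a time step $\Delta t$). *)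

(* Defs.v *)
From mathcomp Require Import all_boot all_order all_algebra.
From mathcomp Require Import boolp classical_sets reals.

Set Implicit Arguments.
Unset Strict Implicit.
Unset Printing Implicit Defensive.

Import Order.TTheory GRing.Theory Num.Theory.
Local Open Scope classical_set_scope.
Local Open Scope ring_scope.

Definition rho (R : realType) (mu w q : R) : R :=
  Num.sqrt
    (((q - w) ^+ 2 + w ^+ 2) / ((q + mu * w) ^+ 2 + mu ^+ 2 * w ^+ 2)
     * (((q - w) ^+ 2 + w ^+ 2)
        / ((q + 1 / mu * w) ^+ 2 + 1 / mu ^+ 2 * w ^+ 2))).

Definition rho_values (R : realType) (mu w1 w2 q : R) : set R :=
  [set rho mu w q | w in [set w | w1 <= w <= w2]].

(* [sup] is total, so it is the maximum only when it belongs to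
   [rho_values mu w1 w2 q]; the theorem asserts this separately. *)
Definition max_rho (R : realType) (mu w1 w2 q : R) : R :=
  sup (rho_values mu w1 w2 q).

Definition minmax_solution (R : realType) (mu w1 w2 q : R) : Prop :=
  0 < q /\ forall q', 0 < q' -> max_rho mu w1 w2 q <= max_rho mu w1 w2 q'.

(* Main.v *)
Require Import Defs.
From mathcomp Require Import all_boot all_order all_algebra.
From mathcomp Require Import boolp classical_sets reals.
From mathcomp Require Import ring.

Import Order.TTheory GRing.Theory Num.Theory.
Local Open Scope classical_set_scope.
Local Open Scope ring_scope.

(** Write [u = ((q - w)^2 + w^2) / (q w) = q/w + 2 w/q - 2] and
    [k = mu + 1/mu].  The product of the two denominators of [rho^2] is
    [(q w)^2 (u^2 + 2 (k+2) u + 2 k (k+2))], so [rho] depends on [(w, q)] only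
    through [u], and

      [rho^2 = u^2 / (u^2 + 2 (k+2) u + 2 k (k+2))]

    is strictly increasing in [u > 0] ([rhoE], [contraction_lt]).  The problem
    is thus the min-max problem for [u], whatever [mu] is.

    As a function of [w], [u] decreases up to [w = q / sqrt 2] and increases
    afterwards, so its maximum over [[w1, w2]] is attained at an endpoint
    ([mismatch_le_endpoint]).  At [q* = sqrt (2 w1 w2)] the two endpoint values
    agree ([mismatch_equioscillation]).  Raising [q] above [q*] strictly
    increases the value at [w1], since [q* > sqrt 2 w1]; lowering [q] below [q*]
    strictly increases the value at [w2], since [q* < sqrt 2 w2]
    ([exists_endpoint_worse]).  Hence every [q <> q*] is strictly worse. *)

(** * The convergence factor as a function of one variable *)

(** This is [q/w + 2 w/q - 2], kept as a quotient because its positivity is then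
    evident. *)
Definition mismatch {R : realFieldType} (w q : R) : R :=
  ((q - w) ^+ 2 + w ^+ 2) / (q * w).

Definition contraction {R : realFieldType} (k u : R) : R :=
  u ^+ 2 / (u ^+ 2 + 2 * (k + 2) * u + 2 * k * (k + 2)).

Lemma mismatch_gt0 {R : realFieldType} (w q : R) :
  0 < w -> 0 < q -> 0 < mismatch w q.
Proof.
move=> w0 q0; rewrite divr_gt0 ?mulr_gt0//.
by rewrite ltr_wpDl ?sqr_ge0// exprn_gt0.
Qed.

Lemma contraction_den_gt0 {R : realFieldType} (k u : R) : 0 < k -> 0 < u ->
  0 < u ^+ 2 + 2 * (k + 2) * u + 2 * k * (k + 2).
Proof.
by move=> k0 u0; rewrite !addr_gt0 ?mulr_gt0 ?exprn_gt0 ?addr_gt0.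
Qed.

(** After cross-multiplication the quartic terms cancel, and the difference
    factors as [v - u] times a positive quantity. *)
Lemma contraction_lt {R : realFieldType} (k u v : R) : 0 < k -> 0 < u -> u < v ->
  contraction k u < contraction k v.
Proof.
move=> k0 u0 uv; have v0 : 0 < v by exact: lt_trans uv.
rewrite /contraction ltr_pdivrMr ?contraction_den_gt0//.
rewrite mulrAC ltr_pdivlMr ?contraction_den_gt0//.
rewrite -subr_gt0.
have -> : v ^+ 2 * (u ^+ 2 + 2 * (k + 2) * u + 2 * k * (k + 2)) -
    u ^+ 2 * (v ^+ 2 + 2 * (k + 2) * v + 2 * k * (k + 2)) =
  (v - u) * (2 * (k + 2) * (u * v) + 2 * k * (k + 2) * (u + v)) by ring.
by rewrite mulr_gt0 ?subr_gt0// !(addr_gt0, mulr_gt0).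
Qed.

(** Each numerator is [q w u]; the cross terms of the two denominators combine
    because [mu] and [1/mu] are mutually inverse, leaving a function of [u] and
    of [mu + 1/mu] alone. *)
Lemma rhoE {R : realType} (mu w q : R) : 0 < mu -> 0 < w -> 0 < q ->
  rho mu w q = Num.sqrt (contraction (mu + 1 / mu) (mismatch w q)).
Proof.
move=> mu0 w0 q0; have [mun wn qn] : [/\ mu != 0, w != 0 & q != 0].
  by rewrite !gt_eqF.
have k0 : 0 < mu + 1 / mu by rewrite addr_gt0 ?divr_gt0.
have u0 : 0 < mismatch w q by exact: mismatch_gt0.
have qw0 : (q * w) ^+ 2 != 0 by rewrite expf_neq0 ?mulf_neq0.
rewrite /rho /contraction; congr Num.sqrt; rewrite mulf_div.
set k := mu + 1 / mu in k0 *; set u := mismatch w q in u0 *.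
have -> : ((q - w) ^+ 2 + w ^+ 2) * ((q - w) ^+ 2 + w ^+ 2) =
    (q * w) ^+ 2 * u ^+ 2.
  by rewrite /u /mismatch; field; rewrite wn qn.
have -> : ((q + mu * w) ^+ 2 + mu ^+ 2 * w ^+ 2) *
    ((q + 1 / mu * w) ^+ 2 + 1 / mu ^+ 2 * w ^+ 2) =
    (q * w) ^+ 2 * (u ^+ 2 + 2 * (k + 2) * u + 2 * k * (k + 2)).
  by rewrite /u /k /mismatch; field; rewrite mun wn qn.
by rewrite -mulf_div divff// mul1r.
Qed.

Lemma rho_lt {R : realType} (mu w q w' q' : R) :
  0 < mu -> 0 < w -> 0 < q -> 0 < w' -> 0 < q' ->
  mismatch w q < mismatch w' q' -> rho mu w q < rho mu w' q'.
Proof.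
move=> mu0 w0 q0 w'0 q'0 lt_u; rewrite !rhoE//.
have k0 : 0 < mu + 1 / mu by rewrite addr_gt0 ?divr_gt0.
rewrite ltr_sqrt; first by apply: contraction_lt => //; exact: mismatch_gt0.
by rewrite divr_gt0 ?exprn_gt0 ?contraction_den_gt0 ?mismatch_gt0.
Qed.

Lemma rho_le {R : realType} (mu w q w' q' : R) :
  0 < mu -> 0 < w -> 0 < q -> 0 < w' -> 0 < q' ->
  mismatch w q <= mismatch w' q' -> rho mu w q <= rho mu w' q'.
Proof.
move=> mu0 w0 q0 w'0 q'0; rewrite le_eqVlt => /predU1P[eq_u|lt_u].
  by rewrite !rhoE// eq_u.
exact/ltW/rho_lt.
Qed.

(** * Monotonicity in the frequency and in the parameter *)

Lemma mismatch_subl {R : realFieldType} (w w' q : R) : 0 < w -> 0 < w' -> 0 < q ->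
  mismatch w' q - mismatch w q =
  (w' - w) * (2 * w * w' - q ^+ 2) / (q * w * w').
Proof.
move=> w0 w'0 q0; rewrite /mismatch; field.
by rewrite !gt_eqF.
Qed.

Lemma mismatch_subr {R : realFieldType} (w q q' : R) : 0 < w -> 0 < q -> 0 < q' ->
  mismatch w q' - mismatch w q =
  (q' - q) * (q * q' - 2 * w ^+ 2) / (w * q * q').
Proof.
move=> w0 q0 q'0; rewrite /mismatch; field.
by rewrite !gt_eqF.
Qed.

(** If [2 w1 w <= q^2] then moving from [w] to [w1] does not lower the mismatch;
    otherwise [q^2 < 2 w1 w <= 2 w w2], and moving to [w2] does not. *)
Lemma mismatch_le_endpoint {R : realFieldType} (w1 w2 w q : R) :
  0 < w1 -> 0 < q -> w1 <= w <= w2 ->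
  mismatch w q <= mismatch w1 q \/ mismatch w q <= mismatch w2 q.
Proof.
move=> w10 q0 /andP[w1w ww2].
have w0 : 0 < w by exact: lt_le_trans w1w.
have w20 : 0 < w2 by exact: lt_le_trans ww2.
have [le_q|lt_q] := leP (2 * w1 * w) (q ^+ 2); [left|right].
  rewrite -subr_le0 mismatch_subl// pmulr_lle0 ?invr_gt0 ?mulr_gt0//.
  by rewrite mulr_ge0_le0 ?subr_ge0 ?subr_le0.
rewrite -subr_ge0 mismatch_subl// divr_ge0//; last by rewrite ltW ?mulr_gt0.
rewrite mulr_ge0 ?subr_ge0// (le_trans (ltW lt_q))//.
rewrite -!mulrA ler_pM2l// mulrC ler_pM2l//.
exact: le_trans ww2.
Qed.

Lemma mismatch_equioscillation {R : rcfType} (w1 w2 : R) :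
  0 < w1 -> 0 < w2 ->
  mismatch w1 (Num.sqrt (2 * w1 * w2)) = mismatch w2 (Num.sqrt (2 * w1 * w2)).
Proof.
move=> w10 w20; apply/esym/eqP.
have q0 : 0 < Num.sqrt (2 * w1 * w2) by rewrite sqrtr_gt0 !mulr_gt0.
rewrite -subr_eq0 mismatch_subl// sqr_sqrtr ?subrr ?mulr0 ?mul0r//.
by rewrite ltW ?mulr_gt0.
Qed.

(** With [p = sqrt (2 w1 w2)], the sign of the change in [q] at [w] is that of
    [(q - p) (p q - 2 w^2)].  For [q > p], [p q > p^2 = 2 w1 w2 > 2 w1^2], so
    [w1] serves; for [q < p], [p q < 2 w1 w2 < 2 w2^2], so [w2] does. *)
Lemma exists_endpoint_worse {R : rcfType} (w1 w2 q : R) :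
  0 < w1 -> w1 < w2 -> 0 < q -> q != Num.sqrt (2 * w1 * w2) ->
  mismatch w1 (Num.sqrt (2 * w1 * w2)) < mismatch w1 q \/
  mismatch w2 (Num.sqrt (2 * w1 * w2)) < mismatch w2 q.
Proof.
move=> w10 w12 q0; have w20 : 0 < w2 by exact: lt_trans w12.
have p0 : 0 < Num.sqrt (2 * w1 * w2) by rewrite sqrtr_gt0 !mulr_gt0.
have p2 : Num.sqrt (2 * w1 * w2) ^+ 2 = 2 * w1 * w2.
  by rewrite sqr_sqrtr// ltW ?mulr_gt0.
move: p0 p2; set p := Num.sqrt _ => p0 p2.
rewrite neq_lt => /orP[qp|pq]; [right|left]; rewrite -subr_gt0.
  rewrite mismatch_subr// divr_gt0 ?(mulr_gt0 (mulr_gt0 _ _))//.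
  rewrite nmulr_rgt0 subr_lt0//.
  have : p * q < p ^+ 2 by rewrite expr2 ltr_pM2l.
  by rewrite p2 => /lt_trans; apply; rewrite expr2 mulrA ltr_pM2r// ltr_pM2l.
rewrite mismatch_subr// divr_gt0 ?mulr_gt0 ?subr_gt0//.
have : p ^+ 2 < p * q by rewrite expr2 ltr_pM2l.
by rewrite p2; apply: lt_trans; rewrite expr2 mulrA ltr_pM2l// mulr_gt0.
Qed.

(** * The maximum over the frequency range *)

Lemma sup_of_max {R : realType} (A : set R) (m : R) :
  A m -> ubound A m -> sup A = m.
Proof.
move=> Am ubm; apply/eqP; rewrite eq_le; apply/andP; split.
  by apply: ge_sup => //; exists m.
by apply: ub_le_sup => //; exists m.
Qed.

(** By [mismatch_le_endpoint] and the monotonicity of [rho] in the mismatch, no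
    frequency beats both endpoints, so the supremum is attained at one of them. *)
Lemma max_rhoE {R : realType} (mu w1 w2 q : R) :
  0 < mu -> 0 < w1 -> w1 < w2 -> 0 < q ->
  [/\ max_rho mu w1 w2 q = Num.max (rho mu w1 q) (rho mu w2 q),
      rho_values mu w1 w2 q (max_rho mu w1 w2 q) &
      ubound (rho_values mu w1 w2 q) (max_rho mu w1 w2 q)].
Proof.
move=> mu0 w10 w12 q0; have w20 : 0 < w2 by exact: lt_trans w12.
set m := Num.max _ _.
have mA : rho_values mu w1 w2 q m.
  rewrite /m; case: leP => _; [exists w2|exists w1] => //=.
    by rewrite lexx ltW.
  by rewrite lexx ltW.
have ubm : ubound (rho_values mu w1 w2 q) m.
  move=> _ [w /= w12w <-]; have /andP[w1w _] := w12w.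
  have w0 : 0 < w by exact: lt_le_trans w1w.
  rewrite /m le_max.
  have [le1|le2] := mismatch_le_endpoint w1 w2 w q w10 q0 w12w.
    by rewrite (rho_le mu w q w1 q).
  by rewrite (rho_le mu w q w2 q) ?orbT.
by rewrite /max_rho (sup_of_max _ m mA ubm).
Qed.

Lemma max_rho_lt {R : realType} (mu w1 w2 q : R) :
  0 < mu -> 0 < w1 -> w1 < w2 -> 0 < q -> q != Num.sqrt (2 * w1 * w2) ->
  max_rho mu w1 w2 (Num.sqrt (2 * w1 * w2)) < max_rho mu w1 w2 q.
Proof.
move=> mu0 w10 w12 q0 qp; have w20 : 0 < w2 by exact: lt_trans w12.
have p0 : 0 < Num.sqrt (2 * w1 * w2) by rewrite sqrtr_gt0 !mulr_gt0.
have [-> _ _] := max_rhoE mu w1 w2 _ mu0 w10 w12 p0.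
have [-> _ _] := max_rhoE mu w1 w2 _ mu0 w10 w12 q0.
have eq_rho : rho mu w1 (Num.sqrt (2 * w1 * w2)) =
              rho mu w2 (Num.sqrt (2 * w1 * w2)).
  by rewrite !rhoE// mismatch_equioscillation.
have [lt1|lt2] := exists_endpoint_worse w1 w2 q w10 w12 q0 qp; rewrite lt_max.
  by rewrite -eq_rho maxxx rho_lt.
by rewrite eq_rho maxxx orbC rho_lt.
Qed.

Theorem theorem3p4 (R : realType) (nu1 nu2 mu w1 w2 : R)
  (hnu1 : 0 < nu1) (hnu2 : 0 < nu2) (hmu : mu = Num.sqrt (nu1 / nu2))
  (hw1 : 0 < w1) (hw12 : w1 < w2) :
  (forall q : R, 0 < q ->
     rho_values mu w1 w2 q (max_rho mu w1 w2 q)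
     /\ ubound (rho_values mu w1 w2 q) (max_rho mu w1 w2 q))
  /\ unique (minmax_solution mu w1 w2) (Num.sqrt (2 * w1 * w2)).
Proof.
have mu0 : 0 < mu by rewrite hmu sqrtr_gt0 divr_gt0.
have p0 : 0 < Num.sqrt (2 * w1 * w2).
  by rewrite sqrtr_gt0 !mulr_gt0// (lt_trans hw1).
split; first by move=> q q0; have [] := max_rhoE mu w1 w2 q mu0 hw1 hw12 q0.
split.
  split=> // q q0; have [->//|qp] := eqVneq q (Num.sqrt (2 * w1 * w2)).
  exact/ltW/max_rho_lt.
move=> q [q0 /(_ _ p0)]; have [->//|qp] := eqVneq q (Num.sqrt (2 * w1 * w2)).
by rewrite leNgt max_rho_lt.
Qed.
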